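(* Let $d,r,n\ge 1$ be integers, let $F=(F_1,\dots,F_r)$ be an affine iterated function system on $\mathbb{R}^d$ satisfying the disjointness and containment assumptions (A1), (A2) described in the context, let $K_n$ be its depth-$n$ set, and let $\gamma>0$. Then there exists a ReLU neural network $\mathcal{N}:\mathbb{R}^d\to\mathbb{R}$ of width $5dr$ and depth $2n+1$ such that $\operatorname{sign}(\mathcal{N}(x))=1$ for every $x\in K_n^\gamma$ and $\operatorname{sign}(\mathcal{N}(x))=-1$ for every $x\in\mathbb{R}^d\setminus K_n$.
   Context: Affine IFS: maps $F_i(x)=M^{(i)}x+v^{(i)}$, $i=1,\dots,r$, with $M^{(i)}\in\mathbb{R}^{d\times d}$ of full rank, $v^{(i)}\in\mathbb{R}^d$, and $\|F_i(x)-F_i(y)\|<\|x-y\|$ for all $x\neq y$ ($\ell_2$ norm). Sets: $K_0=[-1,1]^d$ and $K_n=F_1(K_{n-1})\cup\dots\cup F_r(K_{n-1})$ for $n\ge1$. (A1) There is $\epsilon>0$ such that $d(F_i(K_0),F_j(K_0))>\epsilon$ for all $i\ne j$, where $d(A,B)=\min_{x\in A,y\in B}\|x-y\|$. (A2) $F_i(K_0)\subseteq K_0$ for every $i$. For a set $A$, $A^\gamma=\{x\in A: B_\gamma(x)\subseteq A\}$, where $B_\gamma(x)$ is the ball of radius $\gamma$ around $x$. A ReLU network of depth $t$ and width $k$ on $\mathbb{R}^d$: $x^{(0)}=x$, $x^{(t')}=\sigma(W^{(t')}x^{(t'-1)}+b^{(t')})$ for $1\le t'\le t-1$, and output $x^{(t)}=W^{(t)}x^{(t-1)}+b^{(t)}\in\mathbb{R}$,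 where $W^{(1)}\in\mathbb{R}^{k\times d}$, $W^{(2)},\dots,W^{(t-1)}\in\mathbb{R}^{k\times k}$, $W^{(t)}\in\mathbb{R}^{1\times k}$, $b^{(1)},\dots,b^{(t-1)}\in\mathbb{R}^k$, $b^{(t)}\in\mathbb{R}$, and $\sigma(z)=\max(z,0)$ coordinatewise. *)

(* Defs.v *)
From mathcomp Require Import all_boot all_order all_algebra.
From mathcomp Require Import boolp classical_sets reals.

Set Implicit Arguments.
Unset Strict Implicit.
Unset Printing Implicit Defensive.

Import Order.TTheory GRing.Theory Num.Theory.

Local Open Scope classical_set_scope.
Local Open Scope ring_scope.

(* The norm that MathComp-Analysis puts on matrices is the sup norm, hence a
   separate definition of the Euclidean one. *)
Definition l2norm (R : realType) (d : nat) (x : 'cV[R]_d) : R :=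
  Num.sqrt (\sum_(i < d) x i 0 ^+ 2).

Definition l2ball (R : realType) (d : nat) (x : 'cV[R]_d) (g : R) :
    set 'cV[R]_d :=
  [set y | l2norm (x - y) < g].

(* For nonempty compact A and B this infimum is a minimum. *)
Definition set_dist (R : realType) (d : nat) (A B : set 'cV[R]_d) : R :=
  inf [set l2norm (p.1 - p.2) | p in A `*` B].

Definition erode (R : realType) (d : nat) (A : set 'cV[R]_d) (g : R) :
    set 'cV[R]_d :=
  [set x | A x /\ l2ball x g `<=` A].

Definition affine_map (R : realType) (m p : nat) (W : 'M[R]_(m, p))
    (b : 'cV[R]_m) (x : 'cV[R]_p) : 'cV[R]_m :=
  W *m x + b.

Record affine_ifs (R : realType) (d r : nat) := AffineIFS {
  ifs_mat : 'I_r -> 'M[R]_d;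
  ifs_vec : 'I_r -> 'cV[R]_d;
  ifs_full_rank : forall i, \rank (ifs_mat i) = d;
  ifs_contracting : forall i (x y : 'cV[R]_d), x != y ->
    l2norm (affine_map (ifs_mat i) (ifs_vec i) x -
            affine_map (ifs_mat i) (ifs_vec i) y) < l2norm (x - y)
}.

Definition ifs_map (R : realType) (d r : nat) (F : affine_ifs R d r)
    (i : 'I_r) : 'cV[R]_d -> 'cV[R]_d :=
  affine_map (ifs_mat F i) (ifs_vec F i).

Definition cube (R : realType) (d : nat) : set 'cV[R]_d :=
  [set x | forall i, -1 <= x i 0 <= 1].

Arguments cube R d : clear implicits.

Fixpoint ifs_set (R : realType) (d r : nat) (F : affine_ifs R d r) (n : nat) :
    set 'cV[R]_d :=
  if n is m.+1 then \bigcup_(i in [set: 'I_r]) (ifs_map F i @` ifs_set F m)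
  else cube R d.

Definition ifs_disjoint (R : realType) (d r : nat) (F : affine_ifs R d r) :
    Prop :=
  exists2 e : R, 0 < e & forall i j : 'I_r, i != j ->
    e < set_dist (ifs_map F i @` cube R d) (ifs_map F j @` cube R d).

Definition ifs_contained (R : realType) (d r : nat) (F : affine_ifs R d r) :
    Prop :=
  forall i : 'I_r, ifs_map F i @` cube R d `<=` cube R d.

Definition relu (R : realType) (m : nat) (x : 'cV[R]_m) : 'cV[R]_m :=
  map_mx (fun z => Num.max z 0) x.

(* Pairs (W, b). [relu_mid] lists the square layers 2, ..., t - 1 in order, so
   a network of depth t (counting the affine output layer) has
   size relu_mid = t - 2. *)
Record relu_net (R : realType) (d k : nat) := ReluNet {
  relu_in : 'M[R]_(k, d) * 'cV[R]_k;
  relu_mid : seq ('M[R]_k * 'cV[R]_k);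
  relu_out : 'rV[R]_k * R
}.

Definition relu_depth (R : realType) (d k : nat) (N : relu_net R d k) : nat :=
  (size (relu_mid N)).+2.

Definition relu_layer (R : realType) (m p : nat)
    (l : 'M[R]_(m, p) * 'cV[R]_m) (x : 'cV[R]_p) : 'cV[R]_m :=
  relu (affine_map l.1 l.2 x).

Definition relu_eval (R : realType) (d k : nat) (N : relu_net R d k)
    (x : 'cV[R]_d) : R :=
  let h := foldl (fun y l => relu_layer l y) (relu_layer (relu_in N) x)
                 (relu_mid N) in
  ((relu_out N).1 *m h) 0 0 + (relu_out N).2.

(* Main.v *)
Require Import Defs.
From mathcomp Require Import all_boot all_order all_algebra.
From mathcomp Require Import boolp classical_sets reals.
From mathcomp Require Import zify lra.
(* Unfold x level by level: y_0 = x and y_(k+1) = F_i^-1 (y_k) when y_k lies in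
   F_i(K_0). Each level costs two hidden layers, and a nonnegative scalar (the
   accumulated defect) is carried along. With a = g / 4, the penalty of a point
   z vanishes on the cube of half-width 1 - 2a and is at least 2a off K_0. The
   inverse branch F_i^-1 is computed exactly while the penalty of z = F_i^-1(y)
   is at most a, and it is switched off once that penalty reaches 2a; the
   distortion in between is harmless because the defect of the level is then
   already at its maximal value a. So points outside K_n end with defect at
   least a. Points of the eroded set end with defect 0: F_i is nonexpansive and
   the first-level pieces are separated, so F_i^-1 maps the eroded K_(k+1) into
   the eroded K_k. The network returns a / 2 minus the defect. *)

Set Implicit Arguments.
Unset Strict Implicit.
Unset Printing Implicit Defensive.

Import Order.TTheory GRing.Theory Num.Theory.
Local Open Scope classical_set_scope.
Local Open Scope ring_scope.

(** * The Euclidean norm and the eroded cube *)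

Section EuclideanNorm.
Context {R : realType} {d : nat}.
Implicit Types x y : 'cV[R]_d.

Lemma l2norm_ge0 x : 0 <= l2norm x.
Proof. exact: sqrtr_ge0. Qed.

Lemma l2normZ (t : R) x : l2norm (t *: x) = `|t| * l2norm x.
Proof.
rewrite /l2norm -sqrtr_sqr -sqrtrM ?sqr_ge0// mulr_sumr; congr Num.sqrt.
by apply: eq_bigr => i _; rewrite mxE exprMn.
Qed.

Lemma l2norm0 : l2norm (0 : 'cV[R]_d) = 0.
Proof. by rewrite -(scale0r 0) l2normZ normr0 mul0r. Qed.

Lemma l2norm_delta (j : 'I_d) : l2norm (delta_mx j 0 : 'cV[R]_d) = 1.
Proof.
rewrite /l2norm (bigD1 j)//= big1 => [|i ij]; rewrite mxE ?(negbTE ij) ?eqxx.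
  by rewrite addr0 expr1n sqrtr1.
by rewrite expr0n.
Qed.

Lemma set_dist_le (A B : set 'cV[R]_d) x y :
  A x -> B y -> set_dist A B <= l2norm (x - y).
Proof.
move=> Ax By; apply: ge_inf; last by exists (x, y).
by exists 0 => _ [p _ <-]; exact: l2norm_ge0.
Qed.

(** Test the two points of the ball obtained by moving [x] by [g / 2] along a coordinate axis; half
    the radius keeps them inside the open ball. *)
Lemma erode_cube (g : R) x : 0 < g -> erode (cube R d) g x ->
  forall j, x j 0 <= 1 - g / 2 /\ - x j 0 <= 1 - g / 2.
Proof.
move=> g0 [_ xg] j.
have shift (s : R) : `|s| = g / 2 -> -1 <= x j 0 - s <= 1.
  move=> sg; have /xg/(_ j) : l2ball x g (x - s *: delta_mx j 0).
    by rewrite /l2ball /= opprB addrC subrK l2normZ l2norm_delta sg; lra.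
  by rewrite !mxE !eqxx mulr1.
have /shift/andP[] : `|g / 2| = g / 2 by rewrite ger0_norm; lra.
have /shift/andP[] : `|- (g / 2)| = g / 2 by rewrite normrN ger0_norm; lra.
by move=> *; split; lra.
Qed.

End EuclideanNorm.

(** * Inverse branches, separation of the pieces, and erosion *)

Section IteratedFunctionSystem.
Context {R : realType} {d r : nat} (F : affine_ifs R d r).
Implicit Types (x y z : 'cV[R]_d) (i j : 'I_r).

Definition ifs_inv i y : 'cV[R]_d := invmx (ifs_mat F i) *m (y - ifs_vec F i).

Lemma ifs_mat_unit i : ifs_mat F i \in unitmx.
Proof. by rewrite -row_free_unit /row_free ifs_full_rank. Qed.

Lemma ifs_mapK i : cancel (ifs_map F i) (ifs_inv i).
Proof.
by move=> x; rewrite /ifs_inv /ifs_map /affine_map addrK mulKmx ?ifs_mat_unit.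
Qed.

Lemma ifs_invK i : cancel (ifs_inv i) (ifs_map F i).
Proof.
move=> y.
by rewrite /ifs_inv /ifs_map /affine_map mulKVmx ?ifs_mat_unit// subrK.
Qed.

Lemma ifs_map_le i x y :
  l2norm (ifs_map F i x - ifs_map F i y) <= l2norm (x - y).
Proof.
have [->|xy] := eqVneq x y; first by rewrite !subrr.
exact/ltW/ifs_contracting.
Qed.

Lemma ifs_set_sub_cube n : ifs_contained F -> ifs_set F n `<=` cube R d.
Proof.
move=> FK; elim: n => [//|n IH] _ [i _ [x Kx <-]].
by apply: (FK i); exists x => //; exact: IH.
Qed.

(** Pointwise form of (A1), free of the infimum in [set_dist]. *)
Definition separated (e : R) := forall i j x y, cube R d x -> cube R d y ->
  l2norm (ifs_map F i x - ifs_map F j y) <= e -> i = j.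

Lemma ifs_disjoint_separated :
  ifs_disjoint F -> exists2 e, 0 < e & separated e.
Proof.
move=> [e e0 dF]; exists e => // i j x y Kx Ky xye.
apply/eqP/negPn/negP => /dF; rewrite ltNge => /negP; apply.
by apply: le_trans xye; apply: set_dist_le; [exists x|exists y].
Qed.

Lemma separated_inv e i j y : 0 < e -> separated e ->
  cube R d (ifs_inv i y) -> cube R d (ifs_inv j y) -> i = j.
Proof.
move=> e0 sep Ki Kj; apply: (sep _ _ _ _ Ki Kj).
by rewrite !ifs_invK subrr l2norm0 ltW.
Qed.

(* A segment inside K_(n+1) cannot jump between two first-level pieces:
   consecutive points of a subdivision of mesh < e lie in the same piece. *)
Lemma segment_same_piece e n i z w : 0 < e -> separated e -> ifs_contained F ->
  ifs_set F n z ->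
  (forall t : R, 0 <= t <= 1 -> ifs_set F n.+1
     (ifs_map F i z + t *: (ifs_map F i w - ifs_map F i z))) ->
  ifs_set F n w.
Proof.
move=> e0 sep FK Kz seg.
set u := ifs_map F i z in seg *; set v := ifs_map F i w - u in seg *.
(* The successor makes [N] positive and strictly larger than [l2norm v / e], so the mesh is at most
   [e]. *)
pose N := (Num.truncn (l2norm v / e)).+1.
have N0 : 0 < N%:R :> R by rewrite ltr0n.
have vN : l2norm v / N%:R <= e.
  rewrite ler_pdivrMr// mulrC -ler_pdivrMr//.
  exact/ltW/truncnS_gt.
have walk k : (k <= N)%N ->
    exists2 p, ifs_set F n p & ifs_map F i p = u + (k%:R / N%:R) *: v.
  elim: k => [_|k IH kN]; first by exists z => //; rewrite mul0r scale0r addr0.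
  have [p Kp pE] := IH (ltnW kN).
  have [|j _ [q Kq qE]] := seg (k.+1%:R / N%:R).
    by rewrite divr_ge0//= ler_pdivrMr// mul1r ler_nat.
  suff ji : j = i by exists q => //; rewrite -ji.
  apply: (sep _ _ q p); try exact: (@ifs_set_sub_cube n FK).
  rewrite qE pE opprD addrACA subrr add0r -scalerBl -mulrBl.
  by rewrite -natrB// subSnn l2normZ mul1r ger0_norm ?invr_ge0 ?ler0n// mulrC.
have [p Kp] := walk N (leqnn N).
rewrite divff ?gt_eqF// scale1r /v addrC subrK => /(can_inj (ifs_mapK i)) <-.
exact: Kp.
Qed.

(** For [w] within [g] of the preimage [z], nonexpansiveness keeps the segment from [F_i z = y] to
    [F_i w] in the ball around [y], hence in [K_(n+1)]; so [w] lies in [K_n]. *)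
Lemma erode_ifs_setS e n g y : 0 < e -> separated e -> ifs_contained F ->
  erode (ifs_set F n.+1) g y -> exists i, erode (ifs_set F n) g (ifs_inv i y).
Proof.
move=> e0 sep FK [[i _ [z Kz zy]] yg]; exists i.
have zE : ifs_inv i y = z by rewrite -zy ifs_mapK.
rewrite zE; split=> // w zw.
apply: (@segment_same_piece e n i z w) => // t /andP[t0 t1].
apply: yg; rewrite -zy /l2ball /= opprD addrA subrr add0r -scalerN opprB.
rewrite l2normZ ger0_norm//; apply: le_lt_trans zw.
apply: le_trans (ifs_map_le i z w).
by rewrite ler_piMl ?l2norm_ge0.
Qed.

End IteratedFunctionSystem.

(** * The recurrence on points and defects, and its exact values *)

Section Recurrence.
Context {R : realType} {d r : nat} (F : affine_ifs R d r) (a : R).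
Implicit Types (y z : 'cV[R]_d) (i : 'I_r) (s : 'cV[R]_d * R).

Definition penalty z : R :=
  \sum_j (Num.max (z j 0 - 1 + 2 * a) 0 + Num.max (- z j 0 - 1 + 2 * a) 0).

Definition slope : R := 1 + 2 / a.

(* Equals t on 0 <= t, p <= a, and vanishes once p is large compared to t,
   with a single layer of ReLUs; the second ReLU is shared by all t. *)
Definition gate (t p : R) : R :=
  Num.max (t + slope * (a - p)) 0 - slope * Num.max (a - p) 0.

(** [gate] needs a nonnegative first argument: coordinates in the cube are at least -1, hence the
    shift by 1, undone after the sum. *)
Definition gated_inverse y : 'cV[R]_d :=
  \col_j (\sum_i gate (ifs_inv F i y j 0 + 1) (penalty (ifs_inv F i y)) - 1).

Definition defect y : R :=
  a - \sum_i Num.max (a - penalty (ifs_inv F i y)) 0.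

Definition step s : 'cV[R]_d * R :=
  (gated_inverse s.1, Num.max s.2 0 + defect s.1).

Hypothesis a0 : 0 < a.

Lemma penalty_term_ge0 z j :
  0 <= Num.max (z j 0 - 1 + 2 * a) 0 + Num.max (- z j 0 - 1 + 2 * a) 0.
Proof. by rewrite addr_ge0// le_max lexx orbT. Qed.

(** The penalty grows at least as fast as any coordinate, so one fixed slope suffices to close the
    gate on unbounded inputs. *)
Lemma penalty_ge z j : `|z j 0| - 1 + 2 * a <= penalty z.
Proof.
have le_term : Num.max (z j 0 - 1 + 2 * a) 0
    + Num.max (- z j 0 - 1 + 2 * a) 0 <= penalty z.
  rewrite /penalty (bigD1 j)//= lerDl sumr_ge0// => k _.
  exact: penalty_term_ge0.
apply: le_trans le_term.
have max_ge (x : R) : x <= Num.max x 0 /\ 0 <= Num.max x 0.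
  by rewrite !le_max !lexx orbT.
have [? ?] := max_ge (z j 0 - 1 + 2 * a).
have [? ?] := max_ge (- z j 0 - 1 + 2 * a).
by case: (ger0P (z j 0)) => ?; lra.
Qed.

Lemma penalty_ge0 z : 0 <= penalty z.
Proof. by apply: sumr_ge0 => j _; exact: penalty_term_ge0. Qed.

Lemma penalty_lt_cube z : penalty z < 2 * a -> cube R d z.
Proof.
move=> pz j; rewrite -ler_norml.
by have := penalty_ge z j; lra.
Qed.

Lemma penalty_eq0 z : erode (cube R d) (4 * a) z -> penalty z = 0.
Proof.
have g0 : 0 < 4 * a by rewrite mulr_gt0.
move=> /(erode_cube g0) zK; apply: big1 => j _; have [? ?] := zK j.
rewrite !max_r ?addr0//; lra.
Qed.

Lemma slopeM x : slope * x = x + 2 * (x / a).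
Proof. by rewrite /slope mulrDl mul1r mulrAC -mulrA. Qed.

Lemma slope_ge0 : 0 <= slope.
Proof. by rewrite addr_ge0// divr_ge0// ltW. Qed.

Lemma gate_open t p : 0 <= t -> p <= a -> gate t p = t.
Proof.
move=> t0 pa; rewrite /gate !max_l ?subr_ge0// ?addrK//.
by rewrite addr_ge0// mulr_ge0 ?slope_ge0 ?subr_ge0.
Qed.

(** The summand 1 of [slope] absorbs the growth of [t] with [p]; the summand [2 / a] contributes at
    least 2 once [p - a] reaches [a]. *)
Lemma gate_shut t p : 2 * a <= p -> t <= p - 2 * a + 2 -> gate t p = 0.
Proof.
move=> pa tp; rewrite /gate !max_r ?mulr0 ?subrr//; first by have := a0; lra.
have : 1 <= (p - a) / a by rewrite ler_pdivlMr// mul1r; have := a0; lra.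
by rewrite -(opprB p a) mulrN slopeM; have := a0; lra.
Qed.

Section Separated.
Variable e : R.
Hypotheses (e0 : 0 < e) (sepF : separated F e).

Lemma penalty_other y i j : cube R d (ifs_inv F i y) -> j != i ->
  2 * a <= penalty (ifs_inv F j y).
Proof.
move=> Ki; apply: contraNT; rewrite -ltNge => /penalty_lt_cube Kj.
exact/eqP/(separated_inv e0 sepF Kj Ki).
Qed.

Lemma gated_inverseE y i : penalty (ifs_inv F i y) <= a ->
  gated_inverse y = ifs_inv F i y.
Proof.
move=> pi.
have Ki : cube R d (ifs_inv F i y) by apply: penalty_lt_cube; have := a0; lra.
apply/colP => j; rewrite mxE (bigD1 i)//= big1 => [|k ki].
  rewrite addr0 gate_open ?addrK//.
  by have /andP[? _] := Ki j; lra.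
apply: gate_shut; first exact: penalty_other Ki ki.
have := penalty_ge (ifs_inv F k y) j.
by have := ler_norm (ifs_inv F k y j 0); lra.
Qed.

Lemma defectE y i : penalty (ifs_inv F i y) <= a ->
  defect y = penalty (ifs_inv F i y).
Proof.
move=> pi.
have Ki : cube R d (ifs_inv F i y) by apply: penalty_lt_cube; have := a0; lra.
rewrite /defect (bigD1 i)//= big1 => [|k ki].
  by rewrite addr0 max_l; lra.
by rewrite max_r//; have := penalty_other Ki ki; have := a0; lra.
Qed.

Lemma defect_far y : (forall i, a < penalty (ifs_inv F i y)) -> defect y = a.
Proof.
move=> far; rewrite /defect big1 ?subr0// => i _.
by rewrite max_r//; have := far i; lra.
Qed.

Lemma defect_near_or_far y :
  (exists i, penalty (ifs_inv F i y) <= a) \/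
  (forall i, a < penalty (ifs_inv F i y)).
Proof.
have [[i]|near] := pselect (exists i, penalty (ifs_inv F i y) <= a).
  by left; exists i.
by right => i; rewrite ltNge; apply/negP => pi; apply: near; exists i.
Qed.

(** Separation leaves at most one nonzero summand in [defect]; two close branches could make it
    negative. *)
Lemma defect_ge0 y : 0 <= defect y.
Proof.
have [[i pi]|/defect_far->] := defect_near_or_far y; last exact: ltW.
by rewrite (defectE pi) penalty_ge0.
Qed.

Lemma step_ge s : s.2 <= (step s).2.
Proof.
rewrite /=; apply: (@le_trans _ _ (Num.max s.2 0)).
  by rewrite le_max lexx.
by rewrite lerDl defect_ge0.
Qed.

Lemma iter_step_ge n s : s.2 <= (iter n step s).2.
Proof.
by elim: n => [|n IH] //=; exact: le_trans IH (step_ge _).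
Qed.

(** Either no branch is near, and this step adds [a], which later steps never remove, or the exact
    preimage lies outside [K_n]. The arbitrary [b] lets the induction pass through accumulated
    defects. *)
Lemma iter_step_outside n y b :
  ~ ifs_set F n.+1 y -> a <= (iter n.+1 step (y, b)).2.
Proof.
elim: n y b => [|n IH] y b Ky; rewrite iterSr.
all: have [[i pi]|/defect_far far] := defect_near_or_far y; last first.
1,3: apply: le_trans (iter_step_ge _ _) => /=.
1,2: by rewrite far lerDr le_max lexx orbT.
- case: Ky; exists i => //; exists (ifs_inv F i y); last exact: ifs_invK.
  by apply: penalty_lt_cube; have := a0; lra.
- rewrite /step /= (gated_inverseE pi); apply: IH => Ki; apply: Ky.
  by exists i => //; exists (ifs_inv F i y); last exact: ifs_invK.
Qed.

Lemma iter_step_inside n y : ifs_contained F ->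
  erode (ifs_set F n) (4 * a) y -> (iter n step (y, 0)).2 = 0.
Proof.
move=> FK; elim: n y => [//|n IH] y /(erode_ifs_setS e0 sepF FK)[i yi].
have p0 : penalty (ifs_inv F i y) = 0.
  apply: penalty_eq0; have [Ky By] := yi.
  by split=> [|w /By]; apply: (ifs_set_sub_cube FK); eassumption.
have pi : penalty (ifs_inv F i y) <= a by rewrite p0 ltW.
rewrite iterSr /step/= (gated_inverseE pi) (defectE pi) p0 maxxx addr0.
exact: IH.
Qed.

End Separated.

End Recurrence.

(** * Functions affine in a hidden layer, and the synthesis of one layer *)

Section AffineRelations.
Context {R : realType} {X : Type} {p : nat} (h : X -> 'cV[R]_p).
Implicit Types f : X -> R.

Definition affine_in f :=
  exists (w : 'rV[R]_p) (c : R), forall x, f x = (w *m h x) 0 0 + c.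

Lemma affine_in_ext f f' : f =1 f' -> affine_in f -> affine_in f'.
Proof. by move=> ff' [w [c fE]]; exists w, c => x; rewrite -ff' fE. Qed.

Lemma affine_in_coord i : affine_in (fun x => h x i 0).
Proof. by exists (delta_mx 0 i), 0 => x; rewrite -rowE mxE addr0. Qed.

Lemma affine_in_cst c : affine_in (fun=> c).
Proof. by exists 0, c => x; rewrite mul0mx mxE add0r. Qed.

Lemma affine_inD f f' :
  affine_in f -> affine_in f' -> affine_in (fun x => f x + f' x).
Proof.
move=> [w [c fE]] [w' [c' f'E]]; exists (w + w'), (c + c') => x.
by rewrite fE f'E mulmxDl [in RHS]mxE addrACA.
Qed.

Lemma affine_inZ k f : affine_in f -> affine_in (fun x => k * f x).
Proof.
move=> [w [c fE]]; exists (k *: w), (k * c) => x.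
by rewrite fE -scalemxAl [in RHS]mxE mulrDr.
Qed.

Lemma affine_inN f : affine_in f -> affine_in (fun x => - f x).
Proof.
by move=> /(affine_inZ (-1)) fN; apply: affine_in_ext fN => x; rewrite mulN1r.
Qed.

Lemma affine_inB f f' :
  affine_in f -> affine_in f' -> affine_in (fun x => f x - f' x).
Proof. by move=> ff /affine_inN; exact: affine_inD. Qed.

Lemma affine_in_sum (I : finType) (f : I -> X -> R) :
  (forall i, affine_in (f i)) -> affine_in (fun x => \sum_i f i x).
Proof.
move=> ff; elim: (index_enum I) => [|i s IH].
  by apply: affine_in_ext (affine_in_cst 0) => x; rewrite big_nil.
by apply: affine_in_ext (affine_inD (ff i) IH) => x; rewrite big_cons.
Qed.

Lemma affine_in_mul m q (W : 'M[R]_(m, q)) (y : X -> 'cV[R]_q) i :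
  (forall j, affine_in (fun x => y x j 0)) ->
  affine_in (fun x => (W *m y x) i 0).
Proof.
move=> yh; have WE x : \sum_j W i j * y x j 0 = (W *m y x) i 0 by rewrite mxE.
by apply: affine_in_ext WE _; apply: affine_in_sum => j; exact: affine_inZ.
Qed.

End AffineRelations.

(** Each [t] gets its own neuron through [enum_rank]; the remaining neurons have zero weights and
    bias, which pads the layer to width [k]. *)
Lemma relu_layer_exists (R : realType) (X : Type) (p k : nat)
    (h : X -> 'cV[R]_p) (T : finType) (f : T -> X -> R) :
  (#|T| <= k)%N -> (forall t, affine_in h (f t)) ->
  exists l : 'M[R]_(k, p) * 'cV[R]_k, forall t,
    affine_in (fun x => relu_layer l (h x)) (fun x => Num.max (f t x) 0).
Proof.
move=> Tk /choice[w /choice[c fE]].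
pose unit_of (t : T) : 'I_k := widen_ord Tk (enum_rank t).
pose row_of (i : 'I_k) : option T := [pick t | unit_of t == i].
exists (\matrix_(i, j) oapp (fun t => w t 0 j) 0 (row_of i),
        \col_i oapp c 0 (row_of i)) => t.
apply: affine_in_ext (affine_in_coord _ (unit_of t)) => x.
rewrite /relu_layer /relu /affine_map /= !mxE fE !mxE.
have rowE : row_of (unit_of t) = Some t.
  rewrite /row_of; case: pickP => [u /eqP|/(_ t)]; last by rewrite eqxx.
  by move=> /(congr1 val)/= /val_inj/enum_rank_inj ->.
rewrite rowE; congr (Num.max (_ + _) 0).
by apply: eq_bigr => j _; rewrite mxE rowE.
Qed.

(** * Realization of the recurrence by two layers per level *)

Section Network.
Context {R : realType} {d r : nat} (F : affine_ifs R d r) (a : R).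
Context {X : Type} {k : nat}.
Hypotheses (d0 : (1 <= d)%N) (r0 : (1 <= r)%N) (dk : (5 * d * r <= k)%N).

Definition state_affine p (h : X -> 'cV[R]_p) (s : X -> 'cV[R]_d * R) :=
  (forall j, affine_in h (fun x => (s x).1 j 0)) /\
  affine_in h (fun x => (s x).2).

Lemma affine_in_ifs_inv p (h : X -> 'cV[R]_p) (y : X -> 'cV[R]_d) i j :
  (forall j, affine_in h (fun x => y x j 0)) ->
  affine_in h (fun x => ifs_inv F i (y x) j 0).
Proof.
move=> yh; apply: affine_in_mul => l.
apply: affine_in_ext (affine_inB (yh l) (affine_in_cst h (ifs_vec F i l 0))).
by move=> x; rewrite !mxE.
Qed.

(* The booleans select the sign of z and the threshold of the ReLU: the pair
   with inner = false recovers z itself, the pair with inner = true gives the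
   penalty terms. [None] carries the accumulated defect. *)
Definition first_layer (t : option ('I_r * 'I_d * (bool * bool)))
    (s : 'cV[R]_d * R) : R :=
  if t is Some (i, j, (sgn, inner)) then
    let z := ifs_inv F i s.1 j 0 in
    (if sgn then z else - z) + (if inner then - 1 + 2 * a else 0)
  else s.2.

Definition second_layer (t : option ('I_r * option 'I_d))
    (s : 'cV[R]_d * R) : R :=
  match t with
  | Some (i, Some j) => ifs_inv F i s.1 j 0 + 1
                        + slope a * (a - penalty a (ifs_inv F i s.1))
  | Some (i, None) => a - penalty a (ifs_inv F i s.1)
  | None => Num.max s.2 0
  end.

(** The layer has [4 * d * r + 1] neurons, and [d * r] is at least 1: this is where the factor 5 in
    the width comes from. *)
Lemma card_first_layer :
  (#|{: option ('I_r * 'I_d * (bool * bool))}| <= k)%N.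
Proof.
rewrite card_option !card_prod !card_ord card_bool.
by apply: leq_trans dk; nia.
Qed.

Lemma card_second_layer : (#|{: option ('I_r * option 'I_d)}| <= k)%N.
Proof.
rewrite card_option card_prod card_option !card_ord.
by apply: leq_trans dk; nia.
Qed.

Lemma maxr_subN (x : R) : Num.max x 0 - Num.max (- x) 0 = x.
Proof. by case: (lerP 0 x) => x0; case: (lerP 0 (- x)) => x0'; lra. Qed.

Lemma step_realized p (h : X -> 'cV[R]_p) (s : X -> 'cV[R]_d * R) :
  state_affine h s ->
  exists (l1 : 'M[R]_(k, p) * 'cV[R]_k) (l2 : 'M[R]_k * 'cV[R]_k),
    state_affine (fun x => relu_layer l2 (relu_layer l1 (h x)))
                 (fun x => step F a (s x)).
Proof.
move=> [yh bh].
have zh := affine_in_ifs_inv _ _ yh.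
have [|l1 h1] := relu_layer_exists (h := h)
    (f := fun t x => first_layer t (s x)) card_first_layer.
  move=> [[[i j] [sgn inner]]|]//=; apply: affine_inD.
    by case: sgn; [|apply: affine_inN]; exact: zh.
  exact: affine_in_cst.
exists l1; set H := (fun x => relu_layer l1 (h x)) in h1 *.
have zH i j : affine_in H (fun x => ifs_inv F i (s x).1 j 0).
  apply: affine_in_ext (affine_inB (h1 (Some (i, j, (true, false))))
                                   (h1 (Some (i, j, (false, false))))) => x.
  by rewrite /= !addr0 maxr_subN.
have pH i : affine_in H (fun x => penalty a (ifs_inv F i (s x).1)).
  apply: affine_in_sum => j.
  apply: affine_in_ext (affine_inD (h1 (Some (i, j, (true, true))))
                                   (h1 (Some (i, j, (false, true))))) => x.
  by rewrite /= !addrA.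
have gH i : affine_in H (fun x => a - penalty a (ifs_inv F i (s x).1)).
  exact: affine_inB (affine_in_cst _ _) (pH i).
have [|l2 h2] := relu_layer_exists (h := H)
    (f := fun t x => second_layer t (s x)) card_second_layer.
  move=> [[i [j|]]|]/=; [|exact: gH|exact: (h1 None)].
  apply: affine_inD; last exact: affine_inZ (gH i).
  exact: affine_inD (zH i j) (affine_in_cst _ _).
exists l2; split=> [j|].
  have E x : \sum_i gate a (ifs_inv F i (s x).1 j 0 + 1)
      (penalty a (ifs_inv F i (s x).1)) - 1 = (step F a (s x)).1 j 0.
    by rewrite mxE.
  apply: affine_in_ext E _; apply: affine_inB; last exact: affine_in_cst.
  apply: affine_in_sum => i; apply: affine_inB.
    exact: (h2 (Some (i, Some j))).
  exact: affine_inZ (h2 (Some (i, None))).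
apply: affine_inD.
  (* The carried scalar crosses both ReLUs, and the second one acts trivially. *)
  apply: affine_in_ext (h2 None) => x /=.
  by rewrite max_l// le_max lexx orbT.
apply: affine_inB; first exact: affine_in_cst.
by apply: affine_in_sum => i; exact: (h2 (Some (i, None))).
Qed.

(** The layer [l1] is kept apart because its input dimension is [p]; together with [ls] it makes the
    [2 * (n + 1)] hidden layers of [n + 1] steps. *)
Lemma iter_step_realized p (h : X -> 'cV[R]_p) (s : X -> 'cV[R]_d * R) n :
  state_affine h s ->
  exists (l1 : 'M[R]_(k, p) * 'cV[R]_k) (ls : seq ('M[R]_k * 'cV[R]_k)),
    size ls = n.*2.+1 /\
    state_affine
      (fun x => foldl (fun y l => relu_layer l y) (relu_layer l1 (h x)) ls)
      (fun x => iter n.+1 (step F a) (s x)).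
Proof.
move=> hs; elim: n => [|n [l1 [ls [lsn IH]]]].
  have [l1 [l2 h2]] := step_realized hs.
  by exists l1, [:: l2].
have [l2 [l3 h3]] := step_realized IH.
exists l1, (ls ++ [:: l2; l3]); split; first by rewrite size_cat lsn addn2.
have E x : foldl (fun y l => relu_layer l y) (relu_layer l1 (h x))
    (ls ++ [:: l2; l3]) = relu_layer l3 (relu_layer l2
    (foldl (fun y l => relu_layer l y) (relu_layer l1 (h x)) ls)).
  by rewrite foldl_cat.
by under eq_fun do rewrite E.
Qed.

End Network.

Theorem theorem1 (R : realType) (d r n : nat)
  (hd : (1 <= d)%N) (hr : (1 <= r)%N) (hn : (1 <= n)%N)
  (F : affine_ifs R d r) (hA1 : ifs_disjoint F) (hA2 : ifs_contained F)
  (g : R) (hg : 0 < g) :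
  exists N : relu_net R d (5 * d * r)%N,
    [/\ relu_depth N = (2 * n + 1)%N,
        forall x : 'cV[R]_d, erode (ifs_set F n) g x ->
          Num.sg (relu_eval N x) = 1 &
        forall x : 'cV[R]_d, (~` ifs_set F n) x ->
          Num.sg (relu_eval N x) = -1].
Proof.
case: n hn => [//|n] _.
have [e e0 sepF] := ifs_disjoint_separated hA1.
(* With this choice the margin [g / 2] of [erode_cube] equals [2 * a], the width of the penalty ramp
   inside the cube. *)
pose a := g / 4; have a0 : 0 < a by rewrite divr_gt0.
have s0 : state_affine (@id 'cV[R]_d) (fun x => (x, 0)).
  by split=> [j|]; [exact: affine_in_coord|exact: affine_in_cst].
have [l1 [ls [lsn [_ out]]]] :=
  iter_step_realized F a hd hr (leqnn _) n s0.
(* The threshold [a / 2] lies strictly between the defect 0 inside and the defects at least [a]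
   outside. *)
have {out}[w [c out]] := affine_inB (affine_in_cst _ (a / 2)) out.
exists (ReluNet l1 ls (w, c)); split.
- by rewrite /relu_depth /= lsn mul2n doubleS addn1.
- move=> x xg; rewrite /relu_eval /= -out.
  rewrite (iter_step_inside a0 e0 sepF hA2) ?subr0 ?gtr0_sg ?divr_gt0//.
  by rewrite (_ : 4 * a = g)// /a; lra.
- move=> x xK; rewrite /relu_eval /= -out ltr0_sg//.
  by have := iter_step_outside a0 e0 sepF 0 xK; lra.
Qed.
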